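(* Let $k, n$ be nonnegative integers. Let $p_1, \dots, p_{k+1}$ be primes (not necessarily distinct) such that $p_i \geq 5$ and $p_i \equiv 2 \pmod 3$ for each $1 \leq i \leq k+1$. Then for any integer $j \not\equiv 0 \pmod{p_{k+1}}$, $$\overline{\mathcal{EO}}\left(p_1^2\cdots p_{k+1}^2\, n + \frac{p_1^2\cdots p_{k}^2\, p_{k+1}(3j+p_{k+1})-1}{3}\right) \equiv 0 \pmod 2,$$ where the empty product $p_1^2\cdots p_k^2$ for $k=0$ is $1$.
   Context: For a nonnegative integer $n$, $\mathcal{EO}(n)$ is the number of partitions of $n$ in which every even part is less than each odd part. $\overline{\mathcal{EO}}(n)$ is the number of partitions counted by $\mathcal{EO}(n)$ in which only the largest even part appears an odd number of times (that is, if the partition has an even part, then the largest even part appears an odd number of times and every other part size that occurs appears an even number of times; if there are no even parts, every part size that occurs appears an even number of times). For example $\overline{\mathcal{EO}}(8)=5$, the relevant partitions being $8$, $4+2+2$, $3+3+2$, $3+3+1+1$, $1+1+1+1+1+1+1+1$. Equivalently (Andrews), $\overline{\mathcal{EO}}(n)$ is given by the generating function $$\sum_{n=0}^{\infty}\overline{\mathcal{EO}}(n)q^n=\frac{(q^4; q^4)_{\infty}^3}{(q^2; q^2)_{\infty}^2},\qquad (a; q)_{\infty}:=\prod_{m\geq 0}(1-aq^m).$$ By convention $\overline{\mathcal{EO}}(m)=0$ for negative integers $m$. *)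

(* Defs.v *)
From mathcomp Require Import all_boot all_order all_algebra.

Set Implicit Arguments.
Unset Strict Implicit.
Unset Printing Implicit Defensive.

Local Open Scope nat_scope.

(* A partition of n is encoded by its multiplicities: [m i] is the number of  *)
(* parts equal to i. Parts and multiplicities are at most n, so ranging over  *)
(* finite functions loses nothing; the index 0 is not a part.                 *)
Definition mults n := {ffun 'I_n.+1 -> 'I_n.+1}.

Definition is_partition n (m : mults n) : bool :=
  (m ord0 == 0 :> nat) && (\sum_(i < n.+1) i * m i == n).

Definition is_part n (m : mults n) (i : 'I_n.+1) : bool := 0 < m i.

Definition even_part n (m : mults n) (i : 'I_n.+1) : bool :=
  is_part m i && ~~ odd i.

Definition odd_part n (m : mults n) (i : 'I_n.+1) : bool :=
  is_part m i && odd i.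

Definition evens_below_odds n (m : mults n) : bool :=
  [forall i, forall j, even_part m i ==> odd_part m j ==> (i < j)].

Definition largest_even_part n (m : mults n) (i : 'I_n.+1) : bool :=
  even_part m i && [forall j, even_part m j ==> (j <= i)].

Definition only_largest_even_odd_times n (m : mults n) : bool :=
  [forall i, is_part m i ==> (odd (m i) == largest_even_part m i)].

Definition EO_partitions n : {set mults n} :=
  [set m | is_partition m & evens_below_odds m].

Definition EObar n : nat :=
  #|[set m in EO_partitions n | only_largest_even_odd_times m]|.

Definition EObarz (z : int) : nat := if z is Posz n then EObar n else 0.

(* Main.v *)
Require Import Defs.
From mathcomp Require Import all_boot all_order all_algebra.
From mathcomp Require Import zify ring.

Set Implicit Arguments.
Unset Strict Implicit.
Unset Printing Implicit Defensive.

Import GRing.Theory.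
Local Open Scope ring_scope.

(** Write (a; q) for the product of the 1 - a q^i over all i >= 0, and (a; q)_m
    for the product of its first m factors.  Modulo 2 the generating function of
    EObar is, by the Frobenius,
      (q^4; q^4)^3 / (q^2; q^2)^2 = (q^4; q^4)^2 = (q^8; q^8),
    and by the pentagonal number theorem (q^8; q^8) is supported on the
    exponents N = 4 k (3 k +- 1), that is, on those with 3 N + 1 = (6 k +- 1)^2.
    So EObar N is even as soon as 3 N + 1 is not a square
    ([odd_EObar_square]).  For the N of the theorem, writing P = p_1 ... p_k and
    p = p_{k+1}, one finds 3 N + 1 = P^2 p (3 p n + 3 j + p), whose last
    factor is prime to p; the p-adic valuation of 3 N + 1 is odd, so 3 N + 1 is
    not a square.

    The generating function itself comes from sorting the partitions by their
    largest even part 2 m (with m = 0 if there is none).  With w = q^2 they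
    contribute
      w^m / ((w^2; w^2)_m (w^(2m+1); w^2)),
    and the sum over m is evaluated by the q-binomial theorem in base w^2
    ([qbinomial], [sum_odd_even_ratio]).

    Power series are replaced by a nilpotent variable: the computation takes
    place with an element y, such that y^(n+1) = 0, of a commutative ring of
    characteristic 2, where 1 - y^i is invertible for i > 0 and every infinite
    product or sum is a finite one; the n-th coefficient is read off in
    F_2[X] / (X^(n+1)).  In this setting the pentagonal number theorem follows
    from Shanks's finite identity ([shanks_pentagonal]), valid in every
    commutative ring. *)

(** * Iterated operations and nilpotent elements *)

Lemma big_ord_extend (R : Type) (idx : R) (op : Monoid.law idx)
    (F : nat -> R) (n m : nat) :
  (n <= m)%N -> (forall i, (n <= i)%N -> F i = idx) ->
  \big[op/idx]_(i < n) F i = \big[op/idx]_(i < m) F i.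
Proof.
move=> le_nm F_idx.
rewrite -!(big_mkord xpredT F) (big_cat_nat (leq0n n) le_nm) /=.
rewrite [X in op _ X]big_nat [X in op _ X]big1 ?Monoid.mulm1 //.
by move=> i /andP[/F_idx].
Qed.

Lemma big_ord_double (R : Type) (idx : R) (op : Monoid.law idx)
    (F : nat -> R) (n : nat) :
  \big[op/idx]_(i < n.*2) F i =
  \big[op/idx]_(k < n) op (F k.*2) (F k.*2.+1).
Proof.
elim: n => [|n IHn]; first by rewrite !big_ord0.
by rewrite doubleS !big_ord_recr /= IHn Monoid.mulmA.
Qed.

Lemma expr_nilpotent (A : pzSemiRingType) (x : A) (n k : nat) :
  x ^+ n = 0 -> (n <= k)%N -> x ^+ k = 0.
Proof. by move=> x_nil /subnK <-; rewrite exprD x_nil mulr0. Qed.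

Lemma unit_1Bnilpotent (A : comUnitRingType) (u : A) (n : nat) :
  u ^+ n = 0 -> 1 - u \is a GRing.unit.
Proof.
move=> u_nil; apply/unitrPr; exists (\sum_(i < n) u ^+ i).
by rewrite -[1 - u]opprB mulNr -subrX1 u_nil sub0r opprK.
Qed.

(** * The q-binomial theorem *)

(** Functional equation of F(z) = sum_m c_m z^m when c satisfies the recurrence
    of the ratio (a; q)_m / (q; q)_m.  The difference of the two sides
    telescopes along d m = c_m (1 - q^m) z^m: d 0 = 0 because of its middle
    factor and d M = 0 because z^M = 0.  Stating the recurrence without division
    keeps the identity valid in every commutative ring. *)
Lemma qbinomial_step (A : comPzRingType) (a q z : A) (c : nat -> A) (M : nat) :
    (forall m, c m.+1 * (1 - q ^+ m.+1) = c m * (1 - a * q ^+ m)) ->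
    z ^+ M = 0 ->
  (\sum_(m < M) c m * z ^+ m) * (1 - z) =
  (1 - a * z) * \sum_(m < M) c m * (z * q) ^+ m.
Proof.
move=> c_rec zM; apply/eqP; rewrite -subr_eq0; apply/eqP.
pose d m := c m * (1 - q ^+ m) * z ^+ m.
rewrite mulr_suml mulr_sumr -sumrB.
transitivity (\sum_(0 <= m < M) (- d m.+1 - - d m)).
  rewrite big_mkord; apply: eq_bigr => m _.
  by rewrite /d c_rec exprMn exprS; ring.
by rewrite telescope_sumr // /d zM expr0 subrr; ring.
Qed.

Lemma qbinomial (A : comPzRingType) (a q z : A) (c : nat -> A) (M K : nat) :
    (forall m, c m.+1 * (1 - q ^+ m.+1) = c m * (1 - a * q ^+ m)) ->
    z ^+ M = 0 ->
  (\sum_(m < M) c m * z ^+ m) * \prod_(i < K) (1 - z * q ^+ i) =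
  \prod_(i < K) (1 - a * (z * q ^+ i)) * \sum_(m < M) c m * (z * q ^+ K) ^+ m.
Proof.
move=> c_rec zM; elim: K => [|K IHK].
  by rewrite !big_ord0 mul1r mulr1 expr0 mulr1.
rewrite !big_ord_recr /= [LHS]mulrA IHK -[LHS]mulrA -[RHS]mulrA; congr (_ * _).
rewrite (qbinomial_step c_rec) ?exprSr ?mulrA //.
by rewrite exprMn zM mul0r.
Qed.

(** * The pentagonal number theorem *)

(** Shanks's finite form of the pentagonal number theorem.  Writing P s n for
    the product of the 1 - z^i over s < i <= n, split the factor 1 - z^n of
    P s n off each summand with s < n and use
    (1 - z^s) P s (n-1) = P (s-1) (n-1): the summand is then the one for n - 1
    plus a difference g s - g (s+1).  What the telescoping leaves and the
    summand s = n are the two new pentagonal powers.  The exponents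
    k (3k -+ 1) / 2 are written k^2 + C(k, 2) and k^2 + C(k+1, 2) to stay free
    of division. *)
Lemma shanks_pentagonal (A : comPzRingType) (z : A) (n : nat) :
  \sum_(s < n.+1) (-1) ^+ s * z ^+ (s * n + 'C(s.+1, 2))
                  * \prod_(s <= i < n) (1 - z ^+ i.+1) =
  1 + \sum_(k < n) (-1) ^+ k.+1 *
        (z ^+ (k.+1 ^ 2 + 'C(k.+1, 2)) + z ^+ (k.+1 ^ 2 + 'C(k.+2, 2))).
Proof.
elim: n => [|n IHn].
  by rewrite big_ord_recr !big_ord0 /= big_geq // add0r addr0 !mulr1.
rewrite [in RHS]big_ord_recr /= addrA -IHn.
pose P s m := \prod_(s <= i < m) (1 - z ^+ i.+1).
pose f s := (-1) ^+ s * z ^+ (s.+1 * n.+1 + 'C(s.+1, 2)) * P s n.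
pose e s := (-1) ^+ s * z ^+ (s * n + 'C(s.+1, 2)) * P s n.
pose g s := if s is t.+1 then f t else 0.
have Prec s m : (s <= m)%N -> P s m.+1 = P s m * (1 - z ^+ m.+1).
  by move=> le_sm; rewrite /P big_nat_recr.
have step s : (s < n.+1)%N ->
    (-1) ^+ s * z ^+ (s * n.+1 + 'C(s.+1, 2)) * P s n.+1 = e s + (g s - g s.+1).
  rewrite ltnS => le_sn; rewrite Prec //.
  case: s le_sn => [|t] lt_tn.
    by rewrite /e /g /f !(mul0n, mul1n) bin_small // expr0 ?addn0; ring.
  have Pt : P t n = (1 - z ^+ t.+1) * P t.+1 n by rewrite /P big_ltn.
  rewrite /e /g /f Pt ['C(t.+2, 2)]binS bin1.
  pose x := (t.+1 * n + 'C(t.+1, 2))%N.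
  have -> : (t.+1 * n.+1 + ('C(t.+1, 2) + t.+1) = x + t.+1 + t.+1)%N by lia.
  have -> : (t.+1 * n + ('C(t.+1, 2) + t.+1) = x + t.+1)%N by lia.
  have -> : (t.+1 * n.+1 + 'C(t.+1, 2) = x + t.+1)%N by lia.
  have -> : (t.+2 * n.+1 + ('C(t.+1, 2) + t.+1) = x + t.+1 + t.+1 + n.+1)%N.
    by lia.
  by rewrite !exprD [(-1) ^+ t.+1]exprS; ring.
rewrite big_ord_recr /=.
rewrite (eq_bigr (fun s : 'I_n.+1 => e s + (g s - g s.+1))); last first.
  by move=> s _; apply: step.
rewrite big_split /= -addrA; congr (_ + _).
rewrite -(big_mkord xpredT (fun s => g s - g s.+1)).
under eq_bigr do rewrite -opprB.
rewrite sumrN telescope_sumr // subr0 /g /f /P !big_geq // !mulr1.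
have -> : (n.+1 * n.+1 + 'C(n.+2, 2) = n.+1 ^ 2 + 'C(n.+2, 2))%N by lia.
have -> : (n.+1 * n.+1 + 'C(n.+1, 2) = n.+1 ^ 2 + 'C(n.+1, 2))%N by lia.
by rewrite [(-1) ^+ n.+1]exprS; ring.
Qed.

(** The summands with s > 0 in Shanks's identity carry a factor z^n, so that
    only the full product survives. *)
Lemma pentagonal_nilpotent (A : comPzRingType) (z : A) (n : nat) :
    z ^+ n = 0 ->
  \prod_(i < n) (1 - z ^+ i.+1) =
  1 + \sum_(k < n) (-1) ^+ k.+1 *
        (z ^+ (k.+1 ^ 2 + 'C(k.+1, 2)) + z ^+ (k.+1 ^ 2 + 'C(k.+2, 2))).
Proof.
move=> z_nil.
rewrite -shanks_pentagonal [RHS]big_ord_recl [X in _ + X]big1 => [|s _].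
  by rewrite /= mul0n bin_small // !expr0 !mul1r addr0 big_mkord.
have zs : z ^+ (lift ord0 s * n + 'C((lift ord0 s).+1, 2)) = 0.
  by rewrite (expr_nilpotent z_nil) // (leq_trans _ (leq_addr _ _)) ?leq_pmull.
by rewrite zs mulr0 mul0r.
Qed.

(** * Summing over the largest even part *)

(** The coefficient (w; w^2)_m / (w^2; w^2)_m of the q-binomial series. *)
Definition odd_even_ratio (A : comUnitRingType) (w : A) (m : nat) : A :=
  \prod_(k < m) ((1 - w ^+ k.*2.+1) / (1 - w ^+ k.*2.+2)).

(** The q-binomial theorem with a = z = w and q = w^2 evaluates the sum as
    (w^2; w^2) / (w; w^2).  In characteristic 2, (w^2; w^4) = (w; w^2)^2, so
    splitting (w^2; w^2) into its odd and even factors gives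
    (w; w^2)^2 (w^4; w^4), and one factor (w; w^2) cancels. *)
Lemma sum_odd_even_ratio (A : comUnitRingType) (w : A) (N : nat) :
    2%N \in [pchar A] -> (0 < N)%N -> w ^+ N = 0 ->
  \sum_(m < N) odd_even_ratio w m * w ^+ m =
  (\prod_(k < N) (1 - w ^+ k.*2.+1)) * \prod_(i < N) (1 - (w ^+ 4) ^+ i.+1).
Proof.
move=> char2 N_gt0 w_nil.
have unit_w k : 1 - w ^+ k.+1 \is a GRing.unit.
  by apply: (@unit_1Bnilpotent _ _ N); rewrite exprAC w_nil expr0n.
have c_rec m : odd_even_ratio w m.+1 * (1 - (w ^+ 2) ^+ m.+1) =
               odd_even_ratio w m * (1 - w * (w ^+ 2) ^+ m).
  rewrite /odd_even_ratio big_ord_recr /= -!exprM -exprS !mul2n doubleS.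
  by rewrite -!mulrA mulVr // mulr1.
have := qbinomial N c_rec w_nil.
set D := \prod_(i < N) (1 - w * _).
have DE : D = \prod_(k < N) (1 - w ^+ k.*2.+1).
  by apply: eq_bigr => k _; rewrite -exprM -exprS mul2n.
have unitD : D \is a GRing.unit.
  by rewrite DE; apply: rpred_prod => k _.
have -> : \sum_(m < N) odd_even_ratio w m * (w * (w ^+ 2) ^+ N) ^+ m = 1.
  rewrite [(w ^+ 2) ^+ N]exprAC w_nil expr0n mulr0.
  rewrite -(prednK N_gt0) big_ord_recl /odd_even_ratio big_ord0 mul1r expr0.
  by rewrite big1 ?addr0 // => i _; rewrite expr0n mulr0.
have -> : \prod_(i < N) (1 - w * (w * (w ^+ 2) ^+ i)) =
          D ^+ 2 * \prod_(i < N) (1 - (w ^+ 4) ^+ i.+1).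
  rewrite DE.
  transitivity (\prod_(i < N) (1 - (w ^+ 2) ^+ i.+1)).
    by apply: eq_bigr => i _; rewrite mulrA -expr2 -exprS.
  rewrite (@big_ord_extend _ _ _ (fun i => 1 - (w ^+ 2) ^+ i.+1) N N.*2).
  - rewrite (@big_ord_double _ _ _ (fun i => 1 - (w ^+ 2) ^+ i.+1)).
    rewrite big_split /=.
    rewrite -prodrXl; congr (_ * _); apply: eq_bigr => i _.
      rewrite -exprM mulnC exprM -[LHS]addr0.
      (* 1 - u^2 and (1 - u)^2 differ by twice u (u - 1). *)
      have := addrr_pchar2 char2 (w ^+ i.*2.+1 * (w ^+ i.*2.+1 - 1)).
      set u := w ^+ _ => <-; ring.
    by rewrite -!exprM; congr (1 - w ^+ _); lia.
  - by rewrite -addnn leq_addr.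
  - move=> i le_Ni; rewrite -exprM (expr_nilpotent w_nil) ?subr0 //; lia.
rewrite mulr1 expr2 mulrAC => /(mulIr unitD) ->.
by rewrite DE.
Qed.

(** * Shapes of partitions and their largest even part *)

(** The multiplicities j that a part i may have when the largest even part is e;
    e = 0 stands for a partition without even parts.  For e even, the test
    [odd i == (e < i)] selects the odd i above e and the even i up to e, which
    are the only possible parts.  This turns the global conditions on a
    partition into independent conditions on each multiplicity. *)
Definition mult_allowed (e i j : nat) : bool :=
  if i == 0 then j == 0
  else if odd i == (e < i)%N then odd j == (i == e)
  else j == 0.

Definition mult_pattern n (e : nat) (m : mults n) : bool :=
  [forall i : 'I_n.+1, mult_allowed e i (m i)].

(** The condition on the sum of the parts is left out, so that the partitions
    of all weights can be summed at once as powers of a nilpotent variable. *)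
Definition eo_shape n (m : mults n) : bool :=
  [&& m ord0 == 0 :> nat, evens_below_odds m & only_largest_even_odd_times m].

Lemma mult_patternP n e (m : mults n) :
  reflect (forall i : 'I_n.+1, mult_allowed e i (m i)) (mult_pattern e m).
Proof. exact: forallP. Qed.

(** If e < e' then the pattern of e excludes the even part e', whereas the
    pattern of e' requires it an odd number of times. *)
Lemma mult_pattern_inj n (e e' : 'I_n.+1) (m : mults n) :
  ~~ odd e -> ~~ odd e' -> mult_pattern e m -> mult_pattern e' m -> e = e'.
Proof.
move=> even_e even_e' /mult_patternP pe /mult_patternP pe'.
have bad (a b : 'I_n.+1) : ~~ odd b -> mult_allowed a b (m b) ->
    mult_allowed b b (m b) -> ~~ (a < b)%N.
  move=> even_b; rewrite /mult_allowed ltnn eqxx.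
  case: ltnP => // lt_ab; rewrite (negPf even_b) /=.
  by rewrite gtn_eqF ?(leq_ltn_trans _ lt_ab) //= => /eqP->.
have [lt_ee'|lt_e'e|] := ltngtP e e'; last exact: ord_inj.
  by have := bad e e' even_e' (pe e') (pe' e'); rewrite lt_ee'.
by have := bad e' e even_e (pe' e) (pe e); rewrite lt_e'e.
Qed.

(** The pattern is that of the largest even part, or of 0 if there is none. *)
Lemma eo_shapeP n (m : mults n) :
  reflect (exists2 e : 'I_n.+1, ~~ odd e & mult_pattern e m) (eo_shape m).
Proof.
apply: (iffP and3P) => [[/eqP m0 /forallP ebo /forallP ole]|].
  have odd_m i : odd (m i) = largest_even_part m i.
    move: (ole i); rewrite /largest_even_part /even_part /is_part.
    by case: posnP => [->|_ /eqP].
  have [[e even_e top_e]|no_even] : (exists2 e, even_part m e &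
      forall i, even_part m i -> (i <= e)%N) \/ even_part m =1 xpred0.
    have [e0 even_e0|] := pickP (even_part m); last by right.
    by left; case: (arg_maxnP val even_e0) => e; exists e.
  - exists e; first by case/andP: even_e.
    apply/mult_patternP => i; rewrite /mult_allowed.
    have [i0|i_gt0] := posnP i.
      by rewrite (_ : i = ord0) ?m0 //; apply: val_inj.
    have [oddi|eveni] := boolP (odd i).
      case: ltnP => [_|le_ie] /=.
        rewrite odd_m /largest_even_part /even_part oddi /= andbF /=.
        rewrite eq_sym eqbF_neg; apply: contraTneq oddi => ->.
        by case/andP: even_e.
      rewrite -leqn0 leqNgt; apply/negP => part_i.
      have /forallP/(_ i) := ebo e.
      by rewrite even_e /odd_part /is_part part_i oddi /= ltnNge le_ie.
    case: ltnP => [lt_ei|le_ie] /=.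
      rewrite -leqn0 leqNgt; apply/negP => part_i.
      have := top_e i; rewrite /even_part /is_part part_i eveni leqNgt lt_ei.
      by move=> /(_ isT).
    rewrite odd_m /largest_even_part; apply/eqP.
    have [/val_inj->|ne_ie] := eqVneq (i : nat) e.
      by rewrite even_e; apply/forallP => j; apply/implyP/top_e.
    apply/negP => /andP[_ /forallP/(_ e)]; rewrite even_e /=.
    by rewrite leqNgt ltn_neqAle ne_ie le_ie.
  - exists ord0 => //; apply/mult_patternP => i; rewrite /mult_allowed.
    have [i0|i_gt0] := posnP i.
      by rewrite (_ : i = ord0) ?m0 //; apply: val_inj.
    have [oddi|eveni] /= := boolP (odd i).
      by rewrite odd_m /largest_even_part no_even.
    have := no_even i; rewrite /even_part /is_part eveni andbT.
    by case: posnP => // ->.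
case=> e even_e /mult_patternP pm.
have m0 : m ord0 == 0 :> nat by have := pm ord0.
have part_gt0 i : is_part m i -> (0 < i)%N.
  rewrite /is_part; case: (posnP i) => // i0.
  by rewrite (_ : i = ord0) ?(eqP m0) //; apply: val_inj.
have part_side i : is_part m i ->
    odd i = (e < i)%N /\ odd (m i) = (i == e :> nat).
  move=> part_i; have := pm i; rewrite /mult_allowed gtn_eqF ?part_gt0 //.
  case: eqP => [-> /eqP ->|_] //.
  by move/eqP=> mi0; rewrite /is_part mi0 in part_i.
have even_le i : even_part m i -> (i <= e)%N.
  by case/andP=> /part_side[-> _]; rewrite -leqNgt.
split=> //.
  apply/forallP => i; apply/forallP => j; apply/implyP => /even_le le_ie.
  apply/implyP => /andP[/part_side[+ _] oj]; rewrite oj => lt_ej.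
  exact: leq_ltn_trans le_ie _.
apply/forallP => i; apply/implyP => part_i.
have [side ->] := part_side i part_i.
rewrite /largest_even_part /even_part part_i side -leqNgt /=.
have [/val_inj->|ne_ie] := eqVneq (i : nat) e.
  by rewrite leqnn /=; apply/eqP/esym/forallP => j; apply/implyP/even_le.
apply/eqP/esym/negP => /andP[le_ie /forallP/(_ e)]; rewrite leqNgt.
rewrite ltn_neqAle ne_ie le_ie implybF /even_part even_e andbT /is_part -leqNgt.
have := pm e; rewrite /mult_allowed ltnn eqxx (negPf even_e) eqxx.
rewrite gtn_eqF ?(leq_trans _ le_ie) ?part_gt0 //.
by case: (m e : nat).
Qed.

(** * The generating function modulo 2 *)

(** The last exponent is the least one at least M whose parity is b. *)
Lemma sum_parity_mul (A : comPzRingType) (u : A) (b : bool) (M : nat) :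
  (\sum_(j < M | odd j == b) u ^+ j) * (1 - u ^+ 2) =
  u ^+ b - u ^+ ((M + ~~ b)./2.*2 + b).
Proof.
elim: M => [|M IHM]; first by rewrite big_ord0 mul0r; case: b; rewrite subrr.
rewrite big_mkcond big_ord_recr -big_mkcond /= mulrDl IHM.
case: eqP => [<-|/eqP ne].
  have -> : ((M + ~~ odd M)./2.*2 + odd M = M)%N by lia.
  have -> : ((M.+1 + ~~ odd M)./2.*2 + odd M = M + 2)%N by lia.
  by rewrite exprD; ring.
rewrite mul0r addr0; congr (_ - u ^+ _).
by lia.
Qed.

Lemma sum_parity_nilpotent (A : comUnitRingType) (u : A) (b : bool) (N : nat) :
    u ^+ N = 0 ->
  \sum_(j < N | odd j == b) u ^+ j = u ^+ b / (1 - u ^+ 2).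
Proof.
move=> u_nil; have unit_u : 1 - u ^+ 2 \is a GRing.unit.
  by apply: (@unit_1Bnilpotent _ _ N); rewrite exprAC u_nil expr0n.
apply: (canRL (mulrK unit_u)).
by rewrite sum_parity_mul [X in _ - X](expr_nilpotent u_nil) ?subr0 //; lia.
Qed.

Definition weight n (m : mults n) : nat := (\sum_(i < n.+1) i * m i)%N.

Lemma sum_eo_shape (V : nmodType) n (F : mults n -> V) :
  \sum_(m | eo_shape m) F m =
  \sum_(e < n.+1 | ~~ odd e) \sum_(m | mult_pattern e m) F m.
Proof.
rewrite (exchange_big_dep (@eo_shape n)) /= => [|e m even_e pm]; last first.
  by apply/eo_shapeP; exists e.
apply: eq_bigr => m /eo_shapeP[e even_e pm].
rewrite (big_pred1 e) // => e'; apply/andP/eqP => [[even_e' pm']|->//].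
exact: mult_pattern_inj pm' pm.
Qed.

(** For a possible part i the sum is a geometric series in y^(2i), times y^e
    if i = e, which accounts for the odd multiplicity of the largest even part.
    The two factors are kept apart because the first one contributes just y^e
    to the product over i. *)
Lemma sum_mult_allowed (A : comUnitRingType) (y : A) n (e i : 'I_n.+1) :
    y ^+ n.+1 = 0 -> ~~ odd e ->
  \sum_(j < n.+1 | mult_allowed e i j) y ^+ (i * j) =
  (if i == e then y ^+ e else 1) *
  (if (0 < i)%N && (odd i == (e < i)%N) then (1 - (y ^+ 2) ^+ i)^-1 else 1).
Proof.
move=> y_nil even_e; rewrite /mult_allowed.
have sum0 (a : nat) : \sum_(j < n.+1 | j == 0%N :> nat) y ^+ (a * j) = 1.
  by rewrite (big_pred1 ord0) //= muln0.
have [i0|i_gt0 /=] := posnP i.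
  by rewrite sum0 mulr1; case: eqP => // <-; rewrite i0.
have [side|no_side] := eqVneq (odd i) (e < i)%N; last first.
  rewrite sum0 mulr1; case: (i =P e) no_side => // ->.
  by rewrite ltnn (negPf even_e).
under eq_bigr do rewrite exprM.
rewrite sum_parity_nilpotent; last by rewrite exprAC y_nil expr0n gtn_eqF.
rewrite [((y ^+ i) ^+ 2)]exprAC; congr (_ * _).
case: (i =P e) => [->|/eqP]; first by rewrite eqxx.
by rewrite -val_eqE => /negPf ->.
Qed.

(** The partitions of largest even part 2k give
    w^k / ((w^2; w^2)_k (w^(2k+1); w^2)) with w = y^2; multiplying by (w; w^2)
    removes the infinite product and leaves (w; w^2)_k in the numerator. *)
Lemma sum_mult_pattern (A : comUnitRingType) (y : A) n (k : nat) :
    y ^+ n.+1 = 0 -> (k.*2 <= n)%N ->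
  (\sum_(m : mults n | mult_pattern k.*2 m) y ^+ weight m) *
    \prod_(i < n.+1) (1 - (y ^+ 2) ^+ i.*2.+1) =
  (y ^+ 2) ^+ k * odd_even_ratio (y ^+ 2) k.
Proof.
move=> y_nil le_kn; pose e : 'I_n.+1 := Ordinal (le_kn : (k.*2 < n.+1)%N).
have even_e : ~~ odd e by rewrite /= odd_double.
set w := y ^+ 2.
have w_nil : w ^+ n.+1 = 0 by rewrite exprAC y_nil expr0n.
pose v i := if (0 < i)%N && (odd i == (k.*2 < i)%N) then (1 - w ^+ i)^-1 else 1.
have -> : \sum_(m : mults n | mult_pattern k.*2 m) y ^+ weight m =
    \prod_(i < n.+1) \sum_(j < n.+1 | mult_allowed e i j) y ^+ (i * j).
  rewrite bigA_distr_big_dep; apply: eq_big => [m|m _].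
    by apply/mult_patternP/familyP.
  by rewrite /weight; elim/big_rec2: _ => [|i a b _ <-]; rewrite ?exprD.
under eq_bigr do rewrite sum_mult_allowed //.
rewrite big_split /= -[X in X * _ * _]big_mkcond /= big_pred1_eq -/w -mulrA.
rewrite -exprM mul2n /=; congr (_ * _).
have -> : \prod_(i < n.+1) v i = \prod_(i < n.+1) (v i.*2.+1 * v i.*2.+2).
  rewrite big_ord_recl {1}/v /= mul1r.
  (* Beyond n the factors are 1, so the range may be doubled and its terms
     grouped by consecutive odd and even indices. *)
  rewrite (@big_ord_extend _ _ _ (fun i => v i.+1) n n.+1.*2); first last.
  - move=> i le_ni; rewrite /v (expr_nilpotent w_nil) // subr0 invr1.
    by case: ifP.
  - by lia.
  by rewrite (@big_ord_double _ _ _ (fun i => v i.+1)).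
rewrite -big_split /= /odd_even_ratio.
have unit_w i : 1 - w ^+ i.+1 \is a GRing.unit.
  by apply: (@unit_1Bnilpotent _ _ n.+1); rewrite exprAC w_nil expr0n.
pose ratio k := (1 - w ^+ k.*2.+1) / (1 - w ^+ k.*2.+2).
rewrite (big_ord_widen n.+1 ratio); last by lia.
rewrite [RHS]big_mkcond; apply: eq_bigr => i _; rewrite /v /= !odd_double.
have -> : (k.*2 < i.*2.+1)%N = (k <= i)%N by lia.
have -> : (k.*2 < i.*2.+2)%N = (k <= i)%N by lia.
case: leqP => _ /=; first by rewrite mulr1 mulVr.
by rewrite mul1r mulrC.
Qed.

(** Both sides are compared after multiplication by (w; w^2), a unit, with
    w = y^2: the q-binomial sum then applies. *)
Lemma eo_generating_function (A : comUnitRingType) (y : A) n :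
    2%N \in [pchar A] -> y ^+ n.+1 = 0 ->
  \sum_(m : mults n | eo_shape m) y ^+ weight m =
  \prod_(i < n.+1) (1 - (y ^+ 8) ^+ i.+1).
Proof.
move=> char2 y_nil; set w := y ^+ 2.
have w_nil : w ^+ n.+1 = 0 by rewrite exprAC y_nil expr0n.
have unitD : \prod_(k < n.+1) (1 - w ^+ k.*2.+1) \is a GRing.unit.
  apply: rpred_prod => k _.
  by apply: (@unit_1Bnilpotent _ _ n.+1); rewrite exprAC w_nil expr0n.
apply: (mulIr unitD); rewrite sum_eo_shape mulr_suml [RHS]mulrC.
rewrite (_ : y ^+ 8 = w ^+ 4); last by rewrite -exprM.
rewrite -sum_odd_even_ratio //.
(* The sum over even e <= n becomes a sum over all m <= n, with e = 2m: the
   additional terms vanish because they contain y^(2m) with 2m > n. *)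
pose G e := if odd e then 0 else w ^+ e./2 * odd_even_ratio w e./2.
transitivity (\sum_(e < n.+1) G e).
  rewrite big_mkcond; apply: eq_bigr => e _; rewrite /G.
  case: ifPn => [even_e|/negPn->//]; rewrite (negPf even_e).
  rewrite -(@sum_mult_pattern _ y n) ?even_halfK //.
  by have := ltn_ord e; lia.
rewrite (@big_ord_extend _ _ _ G n.+1 n.+1.*2) ?big_ord_double /=; first last.
- move=> e le_ne; rewrite /G; case: ifPn => // even_e.
  by rewrite /w -exprM mul2n even_halfK // (expr_nilpotent y_nil) ?mul0r.
- by rewrite -addnn leq_addr.
by apply: eq_bigr => k _; rewrite /G /= odd_double doubleK addr0 mulrC.
Qed.

(** * Reading off coefficients *)

Local Notation truncF2 n := {poly %/ ('X^(n.+1) : {poly 'F_2})}.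

Lemma mk_monicXnS (n : nat) : mk_monic ('X^(n.+1) : {poly 'F_2}) = 'X^(n.+1).
Proof. exact: mk_monic_Xn. Qed.

Lemma qpolyX_exp (n k : nat) :
  ('qX : truncF2 n) ^+ k = in_qpoly ('X^(n.+1)) 'X^k.
Proof. by rewrite rmorphXn. Qed.

Lemma qpolyX_nilpotent (n : nat) : ('qX : truncF2 n) ^+ n.+1 = 0.
Proof.
rewrite qpolyX_exp; apply: val_inj => /=.
by rewrite mk_monicXnS Pdiv.RingMonic.rmodpp ?monicXn.
Qed.

Lemma coef_qpolyX_exp (n k : nat) :
  (('qX : truncF2 n) ^+ k : {poly 'F_2})`_n = (k == n)%:R.
Proof.
have [le_kn|lt_nk] := leqP k n; last first.
  by rewrite (expr_nilpotent (qpolyX_nilpotent n)) // coef0 gtn_eqF.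
rewrite qpolyX_exp in_qpoly_small ?coefXn 1?eq_sym //.
by rewrite mk_monicXnS !size_polyXn.
Qed.

Lemma pchar_truncF2 (n : nat) : 2%N \in [pchar truncF2 n].
Proof. by rewrite pchar_qpoly pchar_Fp. Qed.

(** In the truncated ring the powers above n of the variable are zero, so the
    coefficient of index n counts exactly the multiplicities of weight n. *)
Lemma EObar_coef (n : nat) :
  (EObar n)%:R = ((\sum_(m : mults n | eo_shape m)
                     ('qX : truncF2 n) ^+ weight m) : {poly 'F_2})`_n.
Proof.
rewrite poly_of_qpoly_sum coef_sum.
under eq_bigr do rewrite coef_qpolyX_exp.
rewrite -natr_sum -big_mkcondr /= sum1dep_card; congr (_%:R).
apply: eq_card => m; rewrite !inE /eo_shape /is_partition /weight.
by rewrite -!andbA; case: (_ == n); rewrite ?andbT ?andbF ?andFb //= andbA.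
Qed.

(** The signs of the pentagonal number theorem disappear in characteristic 2. *)
Lemma EObar_pentagonal (n : nat) :
  (EObar n)%:R = (n == 0%N)%:R + \sum_(k < n.+1)
    ((n == 8 * (k.+1 ^ 2 + 'C(k.+1, 2)))%N%:R +
     (n == 8 * (k.+1 ^ 2 + 'C(k.+2, 2)))%N%:R) :> 'F_2.
Proof.
have y_nil := qpolyX_nilpotent n; have char2 := pchar_truncF2 n.
rewrite EObar_coef (eo_generating_function char2 y_nil).
rewrite pentagonal_nilpotent; last by rewrite exprAC y_nil expr0n.
rewrite poly_of_qpolyD coefD; congr (_ + _).
  by rewrite -(expr0 'qX) coef_qpolyX_exp eq_sym.
rewrite poly_of_qpoly_sum coef_sum; apply: eq_bigr => k _.
rewrite -signr_odd; have -> (b : bool) : (-1) ^+ b = 1 :> truncF2 n.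
  by case: b; rewrite // expr1 oppr_pchar2.
by rewrite mul1r poly_of_qpolyD coefD -!exprM !coef_qpolyX_exp ![_ == n]eq_sym.
Qed.

(** Because 24 times the pentagonal number k (3k -+ 1) / 2 is
    (6k -+ 1)^2 - 1. *)
Lemma odd_EObar_square (n : nat) :
  odd (EObar n) -> exists s, (3 * n + 1 = s ^ 2)%N.
Proof.
have pent k : (3 * (8 * (k.+1 ^ 2 + 'C(k.+1, 2))) + 1 = (6 * k + 5) ^ 2)%N.
  by have := mul_bin_diag k.+1 1; rewrite bin1 /=; lia.
have pent' k : (3 * (8 * (k.+1 ^ 2 + 'C(k.+2, 2))) + 1 = (6 * k + 7) ^ 2)%N.
  by have := mul_bin_diag k.+2 1; rewrite bin1 /=; lia.
move=> odd_E; have : (EObar n)%:R != 0 :> 'F_2.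
  by rewrite -(@Fp_nat_mod 2) // modn2 odd_E.
rewrite EObar_pentagonal.
case: (n =P 0%N) => [->|_]; first by exists 1%N.
rewrite add0r => /eqP sum_neq0.
have [k] : exists k : 'I_n.+1, (n == 8 * (k.+1 ^ 2 + 'C(k.+1, 2)))%N ||
    (n == 8 * (k.+1 ^ 2 + 'C(k.+2, 2)))%N.
  apply/existsP; apply: contra_notT sum_neq0 => /existsPn none.
  rewrite big1 // => k _; have := none k.
  by rewrite negb_or => /andP[/negPf-> /negPf->]; rewrite addr0.
case/orP=> /eqP ->; first by rewrite pent; exists (6 * k + 5)%N.
by rewrite pent'; exists (6 * k + 7)%N.
Qed.

(** * The congruence *)

Lemma odd_valuation_neq_square (p P t s : nat) :
  prime p -> (0 < P)%N -> ~~ (p %| t)%N -> (s ^ 2 <> P ^ 2 * p * t)%N.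
Proof.
move=> p_pr P_gt0 ndvd sE.
have t_gt0 : (0 < t)%N by case: t ndvd {sE} => //; rewrite dvdn0.
have /(congr1 odd) : logn p (s ^ 2)%N = logn p (P ^ 2 * p * t)%N by rewrite sE.
rewrite lognX -mulnn !lognM ?muln_gt0 ?P_gt0 ?t_gt0 ?prime_gt0 //.
rewrite (logn_prime _ p_pr) eqxx (@lognE p t) (negPf ndvd) !andbF.
by rewrite oddM !oddD addbb.
Qed.

Theorem theorem1p1 (k n : nat) (p : nat -> nat)
    (p_prime : forall i : nat, (1 <= i <= k.+1)%N -> prime (p i))
    (p_ge5 : forall i : nat, (1 <= i <= k.+1)%N -> (5 <= p i)%N)
    (p_mod3 : forall i : nat, (1 <= i <= k.+1)%N -> p i = 2 %[mod 3])
    (j : int) (j_mod : (j <> 0 %[mod (p k.+1)%:Z])%Z) :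
  EObarz
    ((\prod_(1 <= i < k.+2) (p i)%:Z ^+ 2) * n%:Z +
     (((\prod_(1 <= i < k.+1) (p i)%:Z ^+ 2) * (p k.+1)%:Z
        * (3 * j + (p k.+1)%:Z) - 1) %/ 3)%Z)
  = 0 %[mod 2].
Proof.
have last_range : (1 <= k.+1 <= k.+1)%N by rewrite /= leqnn.
have q_pr := p_prime _ last_range; have q_ge5 := p_ge5 _ last_range.
have q_mod3 := p_mod3 _ last_range.
rewrite big_nat_recr //=; set q := p k.+1 in j_mod q_pr q_ge5 q_mod3 *.
pose P := (\prod_(1 <= i < k.+1) p i)%N.
have P2 : \prod_(1 <= i < k.+1) (p i)%:Z ^+ 2 = (P%:Z) ^+ 2.
  rewrite prodrXl /P; congr (_ ^+ 2).
  by rewrite (big_morph Posz PoszM (erefl _)).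
have P_gt0 : (0 < P)%N.
  rewrite /P big_nat prodn_cond_gt0 // => i /andP[i1 ik].
  by rewrite prime_gt0 // p_prime // i1 ltnW.
have P_mod3 : (P ^ 2 = 1 %[mod 3])%N.
  rewrite /P big_nat; elim/big_ind: _ => // [a b a1 b1|i /andP[i1 ik]].
    by rewrite expnMn -modnMm a1 b1.
  by rewrite -modnXm p_mod3 // i1 ltnW.
rewrite P2.
set a : int := (P%:Z ^+ 2 * q%:Z * (3 * j + q%:Z) - 1).
have a3 : (a %/ 3)%Z * 3 = a.
  apply: divzK; rewrite /a.
  have [u Pu] : exists u, (P ^ 2 = u * 3 + 1)%N.
    by exists (P ^ 2 %/ 3)%N; rewrite {1}(divn_eq (P ^ 2) 3) P_mod3.
  have [v qv] : exists v, (q = v * 3 + 2)%N.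
    by exists (q %/ 3)%N; rewrite {1}(divn_eq q 3) q_mod3.
  have -> : P%:Z ^+ 2 = u%:Z * 3 + 1.
    by rewrite expr2 -PoszM mulnn Pu PoszD PoszM.
  apply/dvdzP; rewrite qv.
  (* With P^2 = 3 u + 1 and q = 3 v + 2, this is the quotient by 3 of
     (3 u + 1) q (3 j + q) - 1, using q^2 = 9 v^2 + 12 v + 4. *)
  exists (u%:Z * (v * 3 + 2)%:Z * (3 * j + (v * 3 + 2)%:Z) + (v * 3 + 2)%:Z * j
          + 3 * v%:Z ^+ 2 + 4 * v%:Z + 1).
  by rewrite PoszD PoszM; ring.
case zE: (_ + _) => [N|N] //=.
rewrite [RHS]mod0n; apply/eqP; rewrite modn2 eqb0.
apply/negP => /odd_EObar_square[s sE].
(* 3 N + 1 = P^2 q t with t prime to q. *)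
pose t : int := 3 * q%:Z * n%:Z + 3 * j + q%:Z.
have tE : (s%:Z ^+ 2 = P%:Z ^+ 2 * q%:Z * t).
  have -> : s%:Z ^+ 2 = 3 * N%:Z + 1 by lia.
  rewrite -zE mulrDr [3 * (a %/ 3)%Z]mulrC a3 /a /t; ring.
apply: (@odd_valuation_neq_square q P `|t|%N s) => //; last first.
  by have := congr1 absz tE; rewrite !(abszM, abszX).
apply/negP => dvd_t; apply: j_mod.
have : (q%:Z %| 3 * j)%Z.
  have -> : 3 * j = t - q%:Z * (3 * n%:Z + 1) by rewrite /t; ring.
  by rewrite rpredB ?dvdz_mulr // dvdzE.
rewrite Gauss_dvdzr => [/dvdz_mod0P->|]; first by rewrite mod0z.
by rewrite coprimezE /= prime_coprime // gtnNdvd // (leq_trans _ q_ge5).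
Qed.
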